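(* There is an absolute constant $C>0$ such that the following holds. Let $n\ge 2$ and let $f:\{0,1\}^n\to\{0,1\}$ be a read-once DNF formula. Under unit costs ($c_i=1$ for all $i$) and the uniform distribution ($p_i=1/2$ for all $i$), there is a non-adaptive strategy $S$ with $$\mathrm{cost}_{c,p}(f,S)\le C\log n\cdot \mathsf{OPT}_{\mathcal A}(f,c,p).$$
   Context: Stochastic Boolean Function Evaluation (SBFE) setup: $f:\{0,1\}^n\to\{0,1\}$ is a known Boolean function, $c\in\mathbb{R}_{>0}^n$ a cost vector and $p\in(0,1)^n$ a probability vector. The unknown input $x\in\{0,1\}^n$ is random with independent coordinates and $\Pr(x_i=1)=p_i$ (written $x\sim p$). The value $x_i$ can only be learned by testing variable $i$, at cost $c_i$. A strategy tests variables sequentially until $f(x)$ is determined, i.e. until $f(x')=f(x)$ for every $x'\in\{0,1\}^n$ agreeing with $x$ on all tested coordinates. An adaptive strategy is a decision tree (the next test may depend on previous outcomes); a non-adaptive strategy is a fixed permutation of $[n]$, with variables tested in that order until $f(x)$ is determined. $\mathrm{cost}_c(f,x,S)$ is the total cost of the tests performed by $S$ on input $x$, and $\mathrm{cost}_{c,p}(f,S)=\mathbb{E}_{x\sim p}[\mathrm{cost}_c(f,x,S)]$. $\mathsf{OPT}_{\mathcal A}(f,c,p)$ (resp. $\mathsf{OPT}_{\mathcal N}(f,c,p)$) is the minimum of $\mathrm{cost}_{c,p}(f,S)$ over all adaptive (resp. non-adaptive) strategies $S$. A DNF formula is a disjunction $T_1\vee\dots\vee T_m$ of terms, each a conjunction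 of literals (variables or negated variables); it is read-once if no variable is negated and distinct terms contain disjoint sets of variables. *)

(* Defs.v *)
From HB Require Import structures.
From mathcomp Require Import all_boot all_order all_algebra.
From mathcomp Require Import perm.
From mathcomp Require Import boolp classical_sets reals exp.
Set Implicit Arguments. Unset Strict Implicit. Unset Printing Implicit Defensive.
Import Order.TTheory GRing.Theory Num.Theory.
Local Open Scope ring_scope.

Definition input (n : nat) := {ffun 'I_n -> bool}.

Definition determined n (f : input n -> bool) (x : input n) (A : {set 'I_n}) : bool :=
  [forall y : input n, [forall i in A, y i == x i] ==> (f y == f x)].

Inductive dtree (n : nat) : Type :=
| Leaf : dtree n
| Node : 'I_n -> dtree n -> dtree n -> dtree n.
Arguments Leaf {n}.

(* Running a decision tree on x, with set A already tested: testing stops as soon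
   as f(x) is determined.  [run_ok] says the tree never runs out of tests before
   f(x) is determined; [run_cost] is the total cost of the performed tests. *)
Fixpoint run_ok n (f : input n -> bool) (x : input n) (A : {set 'I_n}) (t : dtree n) : bool :=
  determined f x A ||
  match t with
  | Leaf => false
  | Node i t0 t1 => run_ok f x (i |: A) (if x i then t1 else t0)
  end.

Fixpoint run_cost {R : realType} n (f : input n -> bool) (c : 'I_n -> R)
    (x : input n) (A : {set 'I_n}) (t : dtree n) : R :=
  if determined f x A then 0 else
  match t with
  | Leaf => 0
  | Node i t0 t1 => c i + run_cost f c x (i |: A) (if x i then t1 else t0)
  end.

Definition adaptive_strategy n (f : input n -> bool) (t : dtree n) : Prop :=
  forall x : input n, run_ok f x finset.set0 t.

Definition prob {R : realType} n (p : 'I_n -> R) (x : input n) : R :=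
  \prod_(i < n) (if x i then p i else 1 - p i).

Definition cost_adaptive {R : realType} n (f : input n -> bool) (c p : 'I_n -> R)
    (t : dtree n) : R :=
  \sum_(x : input n) prob p x * run_cost f c x finset.set0 t.

Definition OPT_A {R : realType} n (f : input n -> bool) (c p : 'I_n -> R) : R :=
  inf [set r | exists t : dtree n, adaptive_strategy f t /\ r = cost_adaptive f c p t]%classic.

(* Non-adaptive strategies: a permutation s of [n]; variable s k is tested at step k
   (k = 0,1,...) iff f(x) is not yet determined by {s 0, ..., s (k-1)}. *)
Definition nonadaptive_cost_on {R : realType} n (f : input n -> bool) (c : 'I_n -> R)
    (s : {perm 'I_n}) (x : input n) : R :=
  \sum_(k < n)
    (if determined f x [set s j | j : 'I_n & (j < k)%N] then 0 else c (s k)).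

Definition cost_nonadaptive {R : realType} n (f : input n -> bool) (c p : 'I_n -> R)
    (s : {perm 'I_n}) : R :=
  \sum_(x : input n) prob p x * nonadaptive_cost_on f c s x.

Definition read_once_DNF n (f : input n -> bool) : Prop :=
  exists ts : seq {set 'I_n},
    pairwise (fun A B : {set 'I_n} => [disjoint A & B]) ts /\
    forall x : input n, f x = has (fun T : {set 'I_n} => [forall i in T, x i]) ts.

(* Main.v *)
(** Order the terms [T] by size and let [w T = 2^-|T|] be the probability that
    [T] is satisfied.  Let [r] be the expected number of terms inspected when the
    terms are revealed one by one, in this order, until a satisfied one appears.

    Adaptive strategies cost at least [r]: before stopping, a strategy must touch
    either every term or a satisfied one, and revealing likelier terms first is
    optimal by an exchange argument.

    A non-adaptive strategy of cost [O(log n) * r] first tests at most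
    [K = 2 * up_log 2 n] variables of each term, term by term, and then everything
    else.  Terms of size at most [K] are revealed completely by their block; the
    longer ones have total probability at most [1/2], so ignoring them costs only
    a factor [2]; and something is left to test after the blocks with probability
    at most [n * 2^-K <= 1/n]. *)

Require Import Defs.
From HB Require Import structures.
From mathcomp Require Import all_boot all_order all_algebra.
From mathcomp Require Import perm.
From mathcomp Require Import boolp classical_sets reals exp.
From mathcomp Require Import fintype finset lra.
Set Implicit Arguments. Unset Strict Implicit. Unset Printing Implicit Defensive.
Import Order.TTheory GRing.Theory Num.Theory.
Local Open Scope ring_scope.

(** * Independence of disjoint sets of variables under the uniform measure *)

Definition sat n (x : input n) (T : {set 'I_n}) : bool := [forall i in T, x i].

Definition indep_of (R : realType) n (T : {set 'I_n}) (F : input n -> R) : Prop :=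
  forall x y : input n, (forall i, i \notin T -> x i = y i) -> F x = F y.

Lemma sat_forallP n (x : input n) (T : {set 'I_n}) :
  reflect (forall i, i \in T -> x i) (sat x T).
Proof. exact: (iffP forall_inP). Qed.

Lemma sat_setU1 n (x : input n) i (T : {set 'I_n}) :
  sat x (i |: T) = x i && sat x T.
Proof.
apply/sat_forallP/andP => [H | [xi /sat_forallP H] j].
  by split; [exact: H (setU11 _ _) | apply/sat_forallP => j jT; exact/H/setU1r].
by rewrite in_setU1 => /predU1P[-> | /H].
Qed.

Section Independence.
Variables (R : realType) (n : nat).
Implicit Types (T : {set 'I_n}) (F : input n -> R).

Definition flip_at (i : 'I_n) (x : input n) : input n :=
  [ffun j => if j == i then ~~ x j else x j].

Lemma flip_atK i : involutive (flip_at i).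
Proof.
by move=> x; apply/ffunP => j; rewrite !ffunE; case: eqP => // _; rewrite negbK.
Qed.

(** Flipping coordinate [i] swaps the inputs with [x i] true and false and preserves [F], so each
    half carries half of the sum. *)
Lemma sum_coord i F : indep_of [set i] F ->
  \sum_(x : input n) (x i)%:R * F x = 2^-1 * \sum_(x : input n) F x.
Proof.
move=> indF.
have E : \sum_(x : input n) (~~ x i)%:R * F x = \sum_(x : input n) (x i)%:R * F x.
  rewrite (reindex_inj (inv_inj (flip_atK i))) /=.
  apply: eq_bigr => x _; rewrite ffunE eqxx negbK; congr (_ * _).
  by apply: indF => j; rewrite inE ffunE => /negbTE ->.
have -> : \sum_(x : input n) F x = \sum_(x : input n) (x i)%:R * F x
    + \sum_(x : input n) (~~ x i)%:R * F x.
  rewrite -big_split; apply: eq_bigr => x _ /=.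
  by rewrite -mulrDl; case: (x i); rewrite /= ?addr0 ?add0r mul1r.
by rewrite E; lra.
Qed.

(** Product rule without the normalisation [2^-n]. Variables of [T] are peeled off one at a time;
    each indicator is absorbed into [F], which stays independent of the rest of [T]. *)
Lemma sum_sat T F : indep_of T F ->
  \sum_(x : input n) (sat x T)%:R * F x = 2^-1 ^+ #|T| * \sum_(x : input n) F x.
Proof.
have [m] := ubnP #|T|; elim: m T F => // m IHm T F /[!ltnS] leTm indF.
case: (set_0Vmem T) => [-> | [i iT]].
  rewrite cards0 expr0 mul1r; apply: eq_bigr => x _.
  by rewrite (_ : sat x _) ?mul1r //; apply/sat_forallP => i; rewrite inE.
rewrite -(setD1K iT) cardsU1 !inE eqxx /= exprS -mulrA mulrCA -(sum_coord (i := i)); last first.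
  by move=> x y xy; apply: indF => j jT; apply: xy; rewrite inE; apply: contraNneq jT => ->.
rewrite -IHm; first last.
- move=> x y xy; rewrite xy ?inE ?eqxx //; congr (_ * _).
  apply: indF => j jT; apply: xy; rewrite !inE (negbTE jT) andbF //.
- by rewrite (cardsD1 i T) iT in leTm.
by apply: eq_bigr => x _; rewrite sat_setU1 andbC -mulnb natrM mulrA.
Qed.

End Independence.

(* Expected number of trials when independent events of probability [w T] are
   tried in the order [s] until one of them occurs. *)
Definition run_length (R : realType) (U : eqType) (w : U -> R) (s : seq U) : R :=
  foldr (fun T a => 1 + (1 - w T) * a) 0 s.

(** * Run lengths: exchange argument and loss from ignoring events *)

Section RunLength.
Variables (R : realType) (U : eqType).
Implicit Types (w : U -> R) (s : seq U).

Lemma run_length_ge0 w s : (forall T, w T <= 1) -> 0 <= run_length w s.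
Proof.
by move=> w_le1; elim: s => //= T s IHs; rewrite addr_ge0 // mulr_ge0 // subr_ge0.
Qed.

(** Swapping [T] with the element [V] just before it increases the run length by [w V - w T],
    nonnegative in a decreasing order; repeated swaps bring [T] to the front. *)
Lemma run_length_move_front w T s :
  (forall T, w T <= 1) -> sorted (fun T1 T2 => w T2 <= w T1) s -> T \in s ->
  run_length w s <= 1 + (1 - w T) * run_length w (rem T s).
Proof.
move=> w_le1; elim: s => //= V s IHs ps; rewrite in_cons eq_sym.
case: eqVneq => [-> // | VT /= Ts].
have wTV : w T <= w V.
  have tr : transitive (fun T1 T2 => w T2 <= w T1).
    by move=> a b c h1 h2; exact: le_trans h2 h1.
  by have /allP := order_path_min tr ps; apply.
have := IHs (path_sorted ps) Ts; set a := run_length w s; set b := run_length w _ => h /=.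
have h1 := w_le1 V; have : (1 - w V) * a <= (1 - w V) * (1 + (1 - w T) * b).
  by rewrite ler_wpM2l // subr_ge0.
by move=> h2; rewrite -/a -/b; lra.
Qed.

(** Ignored events stay in the list with weight [0]. By a union bound none of them occurs with at
    least the probability in the left factor, independently of the others, and then both runs have
    equal length. *)
Lemma run_length_ignore w (P : pred U) s : (forall T, 0 <= w T <= 1) ->
  (1 - \sum_(T <- s | ~~ P T) w T) * run_length (fun T => (P T)%:R * w T) s
  <= run_length w s.
Proof.
move=> w01; elim: s => [|T s IHs]; first by rewrite mulr0.
have w_ge0 V : 0 <= w V by case/andP: (w01 V).
have w_le1 V : w V <= 1 by case/andP: (w01 V).
rewrite big_cons /=; set b := run_length (fun T => _) s in IHs *.
set a := run_length w s in IHs *.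
have b_ge0 : 0 <= b.
  by apply: run_length_ge0 => V; case: (P V); rewrite ?mul1r ?mul0r.
set c := \sum_(j <- s | ~~ P j) w j in IHs *.
have c_ge0 : 0 <= c by exact: sumr_ge0.
have : (1 - w T) * ((1 - c) * b) <= (1 - w T) * a by rewrite ler_wpM2l // subr_ge0.
have h0 := w_ge0 T; have h1 := w_le1 T.
rewrite -/a -/b; case: (P T) => /= h; first lra.
have : 0 <= w T * c * b by rewrite !mulr_ge0.
lra.
Qed.

End RunLength.

Lemma disjoint_setU1 (U : finType) (T A : {set U}) i :
  [disjoint T & i |: A] = (i \notin T) && [disjoint T & A].
Proof.
rewrite ![[disjoint T & _]]disjoint_sym -disjointU1.
by apply: eq_disjoint => j; rewrite !inE.
Qed.

Lemma prob_uniform (R : realType) n (x : input n) :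
  prob (fun _ => 2^-1) x = 2^-1 ^+ n :> R.
Proof.
rewrite /prob (eq_bigr (fun=> 2^-1)) => [|i _]; last by case: (x i) => //; lra.
by rewrite prodr_const card_ord.
Qed.

Lemma sum1_inputs (R : realType) n : \sum_(x : input n) 1 = 2 ^+ n :> R.
Proof. by rewrite sumr_const card_ffun card_bool card_ord -natrX. Qed.

(** * Lower bound for adaptive strategies by a potential function *)

Section LowerBound.
Variables (R : realType) (n : nat) (f : input n -> bool) (ts : seq {set 'I_n}).
Hypothesis fE : forall x, f x = has (sat x) ts.
Implicit Types (A T : {set 'I_n}) (x : input n).
Hypothesis uniq_ts : uniq ts.
Hypothesis disj_ts : {in ts &, forall T1 T2 : {set 'I_n}, T1 != T2 -> [disjoint T1 & T2]}.
Hypothesis ts_n0 : set0 \notin ts.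

Definition weight (T : {set 'I_n}) : R := 2^-1 ^+ #|T|.

Hypothesis sorted_ts : sorted (fun T1 T2 => weight T2 <= weight T1) ts.

Definition agree (A : {set 'I_n}) (x0 x : input n) : bool :=
  [forall i in A, x i == x0 i].

(** Falsity is judged on the whole input, not only on its tested part, so a further test in a
    touched term leaves the predicate unchanged. *)
Definition touched_false (A : {set 'I_n}) (x : input n) : bool :=
  all (fun T : {set 'I_n} => [disjoint T & A] || ~~ sat x T) ts.

Definition untouched (A : {set 'I_n}) := [seq T : {set 'I_n} <- ts | [disjoint T & A]].

Lemma weight_ge0 T : 0 <= weight T.
Proof. by rewrite exprn_ge0 // invr_ge0. Qed.

Lemma weight_le1 T : weight T <= 1.
Proof. by rewrite exprn_ile1 // ?invr_ge0 // invf_le1 // ler1n. Qed.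

Lemma agreeP A x0 x :
  reflect (forall i, i \in A -> x i = x0 i) (agree A x0 x).
Proof.
by apply: (iffP forall_inP) => H i iA; [exact/eqP/H | exact/eqP/H].
Qed.

Lemma agree_determined A x0 x :
  agree A x0 x -> determined f x A = determined f x0 A.
Proof.
have tr (x1 x2 : input n) : agree A x1 x2 -> determined f x1 A -> determined f x2 A.
  move=> a /forallP H; apply/forallP => y; apply/implyP => /agreeP yx2.
  have yx1 : agree A x1 y by apply/agreeP => i iA; rewrite yx2 // (agreeP _ _ _ a).
  by rewrite (eqP (implyP (H y) yx1)) (eqP (implyP (H x2) a)).
move=> a; apply/idP/idP; last exact: tr.
by apply: tr; apply/agreeP => i iA; rewrite (agreeP _ _ _ a).
Qed.

(** Setting all untested variables to false falsifies every term, whereas setting them to true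
    satisfies any untouched one; both completions agree with [x] on [A]. *)
Lemma determined_touched A x :
  determined f x A -> touched_false A x -> untouched A = [::].
Proof.
move=> /forallP det /allP tf.
pose fill b : input n := [ffun i => if i \in A then x i else b].
have fillE b : f (fill b) = f x.
  apply/eqP; apply: (implyP (det _)); apply/forall_inP => i iA.
  by rewrite ffunE iA.
have f0 : f (fill false) = false.
  rewrite fE; apply/hasPn => T Tts; case/orP: (tf T Tts) => [dTA | ].
    have /set0Pn[i iT] : T != set0 by apply: contraNneq ts_n0 => <-.
    apply/negP => /sat_forallP/(_ i iT); rewrite ffunE.
    by rewrite (disjointFr dTA iT).
  apply: contra => /sat_forallP H; apply/sat_forallP => i /H; rewrite ffunE.
  by case: ifP.
case E: (untouched A) => [//|T s].
have : T \in untouched A by rewrite E mem_head.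
rewrite mem_filter => /andP[dTA Tts].
suff : f (fill true) by rewrite fillE -(fillE false) f0.
rewrite fE; apply/hasP; exists T => //; apply/sat_forallP => i iT.
by rewrite ffunE (disjointFr dTA iT).
Qed.

Lemma touched_falseU1 A i x T :
  T \in untouched A -> i \in T ->
  touched_false (i |: A) x = ~~ sat x T && touched_false A x.
Proof.
rewrite mem_filter => /andP[dTA Tts] iT; apply/allP/andP => [H | [xT /allP H] V Vts].
  split.
    by have := H T Tts; rewrite disjoint_setU1 iT.
  apply/allP => V Vts; have := H V Vts; rewrite disjoint_setU1.
  by case: [disjoint V & A]; rewrite ?andbF.
have [-> | VT] := eqVneq V T; first by rewrite xT orbT.
have := H V Vts; rewrite disjoint_setU1.
by rewrite (disjointFl (disj_ts Vts Tts VT) iT).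
Qed.

Lemma untouchedU1 A i T :
  T \in untouched A -> i \in T -> untouched (i |: A) = rem T (untouched A).
Proof.
rewrite mem_filter => /andP[dTA Tts] iT.
rewrite rem_filter ?filter_uniq // -filter_predI; apply: eq_in_filter => V Vts /=.
rewrite disjoint_setU1.
have [-> | VT] := eqVneq V T; first by rewrite iT.
by rewrite (disjointFl (disj_ts Vts Tts VT) iT).
Qed.

Lemma disjointU1_untouched A i T :
  T \in ts -> {in untouched A, forall V : {set 'I_n}, i \notin V} ->
  [disjoint T & i |: A] = [disjoint T & A].
Proof.
move=> Tts H; rewrite disjoint_setU1.
case dTA: [disjoint T & A]; last by rewrite andbF.
by rewrite H // mem_filter dTA.
Qed.

(** Touching [T] adds the requirement that [T] be false, which is independent of the rest because
    [T] is disjoint from [A] and from the other terms. *)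
Lemma sum_touched_false A i x0 T :
  T \in untouched A -> i \in T ->
  \sum_(x | agree A x0 x) (touched_false (i |: A) x)%:R =
  (1 - weight T) * \sum_(x | agree A x0 x) (touched_false A x)%:R :> R.
Proof.
move=> Tun iT.
have := Tun; rewrite mem_filter => /andP[dTA Tts].
rewrite !(big_mkcond (agree A x0)) /=.
pose F x : R := if agree A x0 x then (touched_false A x)%:R else 0.
have indF : indep_of T F.
  move=> x y xy; rewrite /F.
  have -> : agree A x0 x = agree A x0 y.
    by apply/agreeP/agreeP => H j jA; rewrite -H // xy // (disjointFl dTA jA).
  case: ifP => // _; congr (_%:R); congr nat_of_bool.
  apply: eq_in_all => V Vts; have [-> | VT] := eqVneq V T; first by rewrite dTA.
  congr (_ || ~~ _); apply/sat_forallP/sat_forallP => H j jV.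
    by rewrite -xy ?H // (disjointFr (disj_ts Vts Tts VT) jV).
  by rewrite xy ?H // (disjointFr (disj_ts Vts Tts VT) jV).
rewrite mulrBl mul1r -(sum_sat indF) -sumrB; apply: eq_bigr => x _ /=.
rewrite /F (touched_falseU1 x Tun iT); case: (agree _ _ _); last by rewrite mulr0 subr0.
by case: (sat x T); rewrite /= ?mul1r ?mul0r ?subrr ?subr0.
Qed.

Lemma sum_agreeU1 A x0 i (F : input n -> R) : i \notin A ->
  \sum_(x | agree A x0 x) F x =
  \sum_(b : bool) \sum_(x | agree (i |: A) [ffun j => if j == i then b else x0 j] x) F x.
Proof.
move=> iA; rewrite (partition_big (fun x : input n => x i) xpredT) //=.
apply: eq_bigr => b _; apply: eq_bigl => x; apply/andP/agreeP => [[/agreeP H /eqP xi] j | H].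
  rewrite ffunE in_setU1; case: eqP => [-> // | _ /= ]; exact: H.
split; last by rewrite H ?setU11 // ffunE eqxx.
apply/agreeP => j jA; rewrite H ?setU1r // ffunE.
by case: eqP => // ji; rewrite -ji jA in iA.
Qed.

(* The potential of a state is the probability that all touched terms are false,
   given the answers so far, times the [run_length] of the untouched terms.  A
   test in a touched term preserves it on average; by [run_length_move_front], a
   test in an untouched term lowers it by at most 1 on average. *)
Lemma adaptive_lower_bound_from t A x0 :
  (forall x, agree A x0 x -> run_ok f x A t) ->
  (\sum_(x | agree A x0 x) (touched_false A x)%:R) * run_length weight (untouched A)
  <= \sum_(x | agree A x0 x) run_cost f (fun _ => 1) x A t :> R.
Proof.
elim: t A x0 => [|i t0 IH0 t1 IH1] A x0 ok;
  have [det | ndet] := boolP (determined f x0 A).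
(* In a determined state the potential vanishes: each agreeing input satisfies a touched term, or no
   term is left untouched. *)
1,3: rewrite mulr_suml; apply: ler_sum => x ax.
1,2: have dx : determined f x A by rewrite (agree_determined ax).
1,2: rewrite /= dx; case tf: (touched_false A x); last by rewrite mul0r.
1,2: by rewrite (determined_touched dx tf) /= mulr0.
  have a0 : agree A x0 x0 by apply/agreeP.
  by have := ok _ a0; rewrite /= (negbTE ndet).
have ok' x : agree A x0 x -> run_ok f x (i |: A) (if x i then t1 else t0).
  by move=> ax; have := ok _ ax; rewrite /= (agree_determined ax) (negbTE ndet).
have costE : \sum_(x | agree A x0 x) run_cost f (fun _ => 1 : R) x A (Node i t0 t1) =
    \sum_(x | agree A x0 x) 1 +
    \sum_(x | agree A x0 x) run_cost f (fun _ => 1) x (i |: A) (if x i then t1 else t0).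
  rewrite -big_split; apply: eq_bigr => x ax /=.
  by rewrite (agree_determined ax) (negbTE ndet).
rewrite {}costE.
(* A tree may repeat a test; this adds cost without changing the state, so the bound for the branch
   taken suffices. *)
have [iA | iA] := boolP (i \in A).
  rewrite -[leLHS]add0r lerD //; first exact: sumr_ge0.
  have xiE x : agree A x0 x -> x i = x0 i by move/agreeP; apply.
  have -> : \sum_(x | agree A x0 x) run_cost f (fun _ => 1 : R) x (i |: A)
        (if x i then t1 else t0) =
      \sum_(x | agree A x0 x) run_cost f (fun _ => 1) x A (if x0 i then t1 else t0).
    by apply: eq_bigr => x /xiE ->; rewrite (setUidPr _) // sub1set.
  have ok2 x : agree A x0 x -> run_ok f x A (if x0 i then t1 else t0).
    move=> ax; have := ok' x ax; rewrite (xiE _ ax) (setUidPr _) //.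
    by rewrite sub1set.
  by case: (x0 i) ok2 => ok2; [exact: IH1 | exact: IH0].
(* The untouched terms depend on which variables were tested, not on the answers, so the bounds for
   the two answers add up. *)
have step : (\sum_(x | agree A x0 x) (touched_false (i |: A) x)%:R) *
      run_length weight (untouched (i |: A)) <=
    \sum_(x | agree A x0 x) run_cost f (fun _ => 1) x (i |: A)
      (if x i then t1 else t0) :> R.
  rewrite !(sum_agreeU1 _ _ iA) mulr_suml; apply: ler_sum => b _.
  set x1 : input n := [ffun _ => _].
  have xiE x : agree (i |: A) x1 x -> x i = b.
    by move=> /agreeP -> ; rewrite ?setU11 // ffunE eqxx.
  have -> : \sum_(x | agree (i |: A) x1 x) run_cost f (fun _ => 1 : R) x (i |: A)
        (if x i then t1 else t0) =
      \sum_(x | agree (i |: A) x1 x) run_cost f (fun _ => 1) x (i |: A)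
        (if b then t1 else t0).
    by apply: eq_bigr => x /xiE ->.
  have ok2 x : agree (i |: A) x1 x -> run_ok f x (i |: A) (if b then t1 else t0).
    move=> ax; rewrite -(xiE _ ax); apply: ok'; apply/agreeP => j jA.
    rewrite (agreeP _ _ _ ax) ?setU1r // ffunE; case: eqP => // ji.
    by rewrite -ji jA in iA.
  by clearbody x1; case: b xiE ok2 => _ ok2; [exact: IH1 | exact: IH0].
apply: le_trans (lerD (lexx _) step).
(* If [i] lies in an untouched term, the potential drops by at most [Z], hence by at most the number
   of agreeing inputs, which is the total price of this test. *)
case: (boolP (has (fun T : {set 'I_n} => i \in T) (untouched A))) => [/hasP[T Tun iT] | /hasPn noT].
  rewrite (sum_touched_false _ Tun iT) (untouchedU1 Tun iT).
  set Z := \sum_(x | _) _; set r := run_length _ (rem _ _).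
  have Z0 : 0 <= Z :> R by exact: sumr_ge0.
  have Z1 : Z <= \sum_(x | agree A x0 x) 1 :> R.
    by apply: ler_sum => x _; rewrite lern1 leq_b1.
  apply: le_trans (lerD Z1 (lexx _)).
  have tr : transitive (fun T1 T2 : {set 'I_n} => weight T2 <= weight T1).
    by move=> a b c h1 h2; exact: le_trans h2 h1.
  have := run_length_move_front weight_le1 (sorted_filter tr _ sorted_ts) Tun.
  move=> /(ler_wpM2l Z0); rewrite -/r; lra.
have -> : untouched (i |: A) = untouched A.
  by apply: eq_in_filter => T Tts; exact: disjointU1_untouched.
rewrite -[leLHS]add0r lerD //; first exact: sumr_ge0.
rewrite ler_wpM2r ?run_length_ge0 //; first exact: weight_le1.
apply: ler_sum => x _; rewrite ler_nat.
rewrite (_ : touched_false (i |: A) x = touched_false A x) //.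
by apply: eq_in_all => T Tts; rewrite (disjointU1_untouched Tts noT).
Qed.

Lemma adaptive_lower_bound t : adaptive_strategy f t ->
  run_length weight ts <= cost_adaptive f (fun _ => 1) (fun _ => 2^-1) t.
Proof.
move=> ok; pose x0 : input n := [ffun=> false].
have agr x : agree set0 x0 x by apply/agreeP => i; rewrite inE.
have dis (T : {set 'I_n}) : [disjoint T & set0] by rewrite -setI_eq0 setI0.
have := adaptive_lower_bound_from (fun x (_ : agree set0 x0 x) => ok x).
rewrite !(eq_bigl _ _ agr) (_ : untouched set0 = ts); last first.
  by rewrite -[RHS]filter_predT; apply: eq_filter => T; exact: dis.
have -> : \sum_x (touched_false set0 x)%:R = \sum_(x : input n) 1 :> R.
  by apply: eq_bigr => x _; rewrite (_ : touched_false _ _) //; apply/allP => T _; rewrite dis.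
rewrite sum1_inputs => H; rewrite /cost_adaptive.
under eq_bigr do rewrite prob_uniform.
rewrite -mulr_sumr exprVn ler_pdivlMl // exprn_gt0 //.
Qed.

End LowerBound.

Lemma subset_cons_tl (U : eqType) (a : U) (s r : seq U) :
  {subset a :: s <= r} -> {subset s <= r}.
Proof. by move=> sr b bs; apply: sr; rewrite in_cons bs orbT. Qed.

(** * Non-adaptive cost as a count along a list of variables *)

Section TestOrder.
Variables (n : nat) (f : input n -> bool) (x : input n).
Implicit Types (A B : {set 'I_n}) (s r : seq 'I_n).

(** The arbitrary initial set [A] lets the count split over concatenation, so that blocks can be
    analysed one by one. *)
Fixpoint tests_from A s : nat :=
  if s is i :: s' then (~~ determined f x A + tests_from (i |: A) s')%N else 0%N.

Lemma determinedS A B : A \subset B -> determined f x A -> determined f x B.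
Proof.
move=> /subsetP sAB /forallP H; apply/forallP => y; apply/implyP => /forall_inP yB.
by apply: (implyP (H y)); apply/forall_inP => i /sAB; exact: yB.
Qed.

Lemma tests_from_determined A s : determined f x A -> tests_from A s = 0%N.
Proof.
elim: s A => //= i s IHs A det; rewrite det IHs //.
exact: determinedS (subsetUr _ _) det.
Qed.

Lemma tests_from_le A s : (tests_from A s <= size s * ~~ determined f x A)%N.
Proof.
case: (boolP (determined f x A)) => [det | _]; first by rewrite tests_from_determined.
rewrite muln1; elim: s A => //= i s IHs A.
by rewrite -add1n leq_add // leq_b1.
Qed.

Lemma setUU1_seq A i s : A :|: [set j in i :: s] = (i |: A) :|: [set j in s].
Proof. by apply/setP => j; rewrite !inE; case: (j == i); rewrite ?orbT. Qed.

Lemma tests_from_cat A s r :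
  tests_from A (s ++ r) = (tests_from A s + tests_from (A :|: [set j in s]) r)%N.
Proof.
elim: s A => /= [|i s IHs] A; last by rewrite IHs addnA setUU1_seq.
by rewrite (_ : A :|: _ = A) //; apply/setP => j; rewrite !inE orbF.
Qed.

Lemma tests_fromE A s :
  tests_from A s =
  (\sum_(k < size s) ~~ determined f x (A :|: [set j in take k s]))%N.
Proof.
elim: s A => [|i s IHs] A; first by rewrite big_ord0.
rewrite big_ord_recl /= IHs; congr (_ + _)%N.
  by rewrite (_ : A :|: _ = A) //; apply/setP => j; rewrite !inE orbF.
by apply: eq_bigr => k _; rewrite setUU1_seq.
Qed.

Lemma nonadaptive_cost_onE (R : realType) (t : n.-tuple 'I_n) (ut : injective (tnth t)) :
  nonadaptive_cost_on f (fun _ => 1) (perm ut) x = (tests_from set0 t)%:R :> R.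
Proof.
rewrite tests_fromE size_tuple natr_sum; apply: eq_bigr => k _.
rewrite set0U (_ : [set perm ut j | j : 'I_n & (j < k)%N] = [set j in take k t]).
  by case: (determined _ _ _).
apply/setP => i; rewrite !inE; apply/imsetP/idP => [[j] | ].
  rewrite inE => jk ->; rewrite permE (tnth_nth i) -(nth_take i jk).
  by rewrite mem_nth // size_take size_tuple; case: ifP.
move=> /(nthP i)[j]; rewrite size_take size_tuple ltn_ord => jk <-.
exists (Ordinal (ltn_trans jk (ltn_ord k))); first by rewrite inE.
by rewrite permE (tnth_nth i) nth_take.
Qed.

End TestOrder.

(** * Upper bound for the order that tests truncated terms first *)

Section UpperBound.
Variables (R : realType) (n : nat) (f : input n -> bool) (ts : seq {set 'I_n}).
Hypothesis fE : forall x, f x = has (sat x) ts.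
Hypothesis uniq_ts : uniq ts.
Hypothesis disj_ts :
  {in ts &, forall T1 T2 : {set 'I_n}, T1 != T2 -> [disjoint T1 & T2]}.
Hypothesis ts_n0 : set0 \notin ts.
Variable K : nat.
Implicit Types (A T : {set 'I_n}) (x : input n) (s : seq {set 'I_n}).

Definition block T : seq 'I_n := take K (enum T).

Definition blocks s : seq 'I_n := flatten [seq block T | T <- s].

Definition test_order : seq 'I_n :=
  blocks ts ++ [seq i <- enum 'I_n | i \notin blocks ts].

(* Number of blocks begun when scanning stops at the first satisfied term of size
   at most [K]; a longer term is never recognised as satisfied by its block. *)
Fixpoint blocks_run x s : nat :=
  if s is T :: s' then (~~ ((#|T| <= K) && sat x T) * blocks_run x s' + 1)%N else 0%N.

Lemma mem_block T i : i \in block T -> i \in T.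
Proof. by move/mem_take; rewrite mem_enum. Qed.

Lemma block_short T : (#|T| <= K)%N -> block T = enum T.
Proof. by move=> TK; rewrite /block take_oversize // -cardE. Qed.

Lemma card_block T : (K <= #|T|)%N -> #|[set i in block T]| = K.
Proof.
move=> KT; rewrite cardsE; have /card_uniqP -> : uniq (block T).
  by rewrite take_uniq ?enum_uniq.
by rewrite size_take_min -cardE; apply/minn_idPl.
Qed.

Lemma determined_sat A T x :
  T \in ts -> sat x T -> T \subset A -> determined f x A.
Proof.
move=> Tts /sat_forallP xT /subsetP TA; apply/forallP => y; apply/implyP.
move=> /forall_inP yx; rewrite !fE; apply/eqP; transitivity true; last symmetry.
  apply/hasP; exists T => //; apply/sat_forallP => i iT.
  by rewrite (eqP (yx i (TA i iT))) xT.
by apply/hasP; exists T => //; apply/sat_forallP.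
Qed.

(** Each block begun costs at most [K]. A satisfied term of size at most [K] is tested entirely by
    its block, which determines [f] and ends the testing. *)
Lemma tests_from_blocks x A s r : {subset s <= ts} ->
  (tests_from f x A (blocks s ++ r) <=
   K * blocks_run x s + tests_from f x (A :|: [set j in blocks s]) r)%N.
Proof.
elim: s A => [|T s IHs] A sts.
  by rewrite /= muln0 (_ : A :|: _ = A) //; apply/setP => j; rewrite !inE orbF.
rewrite /blocks /= -/(blocks s) -catA tests_from_cat.
have sizeT : (tests_from f x A (block T) <= K)%N.
  apply: leq_trans (tests_from_le _ _ _ _) _.
  by rewrite -[leqRHS]muln1 leq_mul ?leq_b1 // size_take_min geq_minl.
have {IHs} := IHs (A :|: [set j in block T]) (subset_cons_tl sts).
rewrite -setUA (_ : [set j in block T] :|: _ = [set j in block T ++ blocks s]); last first.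
  by apply/setP => j; rewrite !inE mem_cat.
move=> IHs; rewrite mulnDr muln1 [(K * _ + K)%N]addnC -addnA leq_add //.
case: (boolP (_ && _)) => [/andP[TK xT] | _]; last by rewrite mul1n.
rewrite tests_from_determined // (determined_sat (T := T)) ?sts ?mem_head //.
by apply/subsetP => i iT; rewrite !inE block_short // mem_enum iT orbT.
Qed.

(** A satisfied term of size at most [K] would determine [f], and so would a false variable in every
    block. What remains is a longer term whose block is all true; the sum prepares a union bound. *)
Lemma undetermined_after_blocks x :
  (~~ determined f x [set j in blocks ts] <=
   \sum_(T <- ts | (K < #|T|)%N) sat x [set j in block T])%N.
Proof.
case: (boolP (determined _ _ _)) => // ndet.
suff /hasP[T Tts /andP[KT xT]] :
    has (fun T => (K < #|T|)%N && sat x [set j in block T]) ts.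
  by rewrite (big_rem T) //= KT xT.
apply: contraNT ndet => /hasPn H.
case: (boolP (has (fun T => (#|T| <= K)%N && sat x T) ts)) => [/hasP[T Tts /andP[TK xT]] | /hasPn H'].
  apply: (determined_sat Tts xT); apply/subsetP => i iT; rewrite inE.
  by apply/flatten_mapP; exists T => //; rewrite block_short ?mem_enum.
have bfalse T : T \in ts -> exists2 i, i \in block T & ~~ x i.
  move=> Tts.
  have : ~~ sat x [set j in block T].
    have := H T Tts; have := H' T Tts; rewrite leqNgt.
    case: ltnP => //= TK + _; rewrite block_short //.
    by rewrite (_ : [set j in enum T] = T) //; apply/setP => j; rewrite inE mem_enum.
  rewrite negb_forall => /existsP[i]; rewrite negb_imply inE => /andP[ib xi].
  by exists i.
have all_false (y : input n) : (forall i, i \in blocks ts -> y i = x i) -> f y = false.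
  move=> yx; rewrite fE; apply/hasPn => T Tts; have [i ib xi] := bfalse T Tts.
  apply/negP => /sat_forallP/(_ i (mem_block ib)); rewrite yx ?(negbTE xi) //.
  by apply/flatten_mapP; exists T.
apply/forallP => y; apply/implyP => /forall_inP yx.
by rewrite !all_false // => i ib; apply/eqP/yx; rewrite inE.
Qed.

Lemma blocks_run_indep T s : T \notin s -> T \in ts -> {subset s <= ts} ->
  indep_of T (fun x => (blocks_run x s)%:R : R).
Proof.
move=> + Tts + x y xy; elim: s => //= V s IHs; rewrite in_cons negb_or => /andP[TV Ts] sts.
have := IHs Ts (subset_cons_tl sts).
rewrite !natrD !natrM => ->; congr (_%:R * _ + _); congr (nat_of_bool (~~ (_ && _))).
have dTV : [disjoint T & V] by apply: disj_ts => //; rewrite sts ?mem_head.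
apply/sat_forallP/sat_forallP => H j jV.
  by rewrite -xy ?H // (disjointFl dTV jV).
by rewrite xy ?H // (disjointFl dTV jV).
Qed.

(** Satisfaction of [T] is independent of the later blocks, so the expectation follows the recursion
    of [run_length], with weight [0] for terms longer than [K]. *)
Lemma sum_blocks_run s : uniq s -> {subset s <= ts} ->
  \sum_x (blocks_run x s)%:R =
  2 ^+ n * run_length (fun T => (#|T| <= K)%N%:R * weight R T) s.
Proof.
elim: s => /= [|T s IHs]; first by rewrite mulr0 big1.
move=> /andP[Ts us] sts.
have sts' := subset_cons_tl sts.
have := sum_sat (blocks_run_indep Ts (sts _ (mem_head _ _)) sts').
rewrite -/(weight R T) (IHs us sts'); set a := run_length _ _ => E.
have -> : \sum_x ((~~ ((#|T| <= K) && sat x T) * blocks_run x s + 1)%N%:R : R) =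
    \sum_(x : input n) 1 + \sum_x (blocks_run x s)%:R
    - (#|T| <= K)%N%:R * \sum_x (sat x T)%:R * (blocks_run x s)%:R.
  rewrite mulr_sumr -big_split -sumrB; apply: eq_bigr => x _ /=.
  by rewrite natrD natrM; case: (#|T| <= K)%N; case: (sat x T) => /=; lra.
rewrite E (IHs us sts') sum1_inputs -/a; lra.
Qed.

Lemma uniq_blocks : uniq (blocks ts).
Proof.
suff H s : uniq s -> {subset s <= ts} -> uniq (blocks s) by exact: H.
elim: s => //= T s IHs /andP[Ts us] sts.
have sts' := subset_cons_tl sts.
rewrite /blocks /= cat_uniq -/(blocks s) IHs // take_uniq ?enum_uniq //= andbT.
apply/hasPn => i /flatten_mapP[V Vs /mem_block iV]; apply/negP => /mem_block iT.
have VT : V != T by apply: contraNneq Ts => <-.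
have := disj_ts (sts' _ Vs) (sts _ (mem_head _ _)) VT.
by move/disjointFr/(_ iV); rewrite iT.
Qed.

Lemma size_terms : (0 < K)%N -> (size ts <= n)%N.
Proof.
move=> K0; rewrite -[leqRHS]size_enum_ord.
apply: (@leq_trans (size (blocks ts))); last first.
  by apply: uniq_leq_size uniq_blocks _ => i _; rewrite mem_enum.
rewrite /blocks; elim: ts ts_n0 => //= T s IHs; rewrite in_cons negb_or => /andP[T0 s0].
rewrite size_cat -add1n leq_add ?IHs // size_take_min leq_min K0 -cardE card_gt0.
by rewrite eq_sym.
Qed.

Lemma uniq_test_order : uniq test_order.
Proof.
rewrite cat_uniq uniq_blocks filter_uniq ?enum_uniq // andbT /=.
by apply/hasPn => i; rewrite mem_filter => /andP[].
Qed.

Lemma size_test_order : size test_order == n.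
Proof.
rewrite -[X in _ == X]size_enum_ord; apply/eqP/perm_size.
apply: uniq_perm uniq_test_order (enum_uniq _) _ => i.
by rewrite mem_enum mem_cat mem_filter mem_enum /= andbT orbN.
Qed.

(** The first summand pays for the blocks. The second charges at most [n] further tests to each long
    term whose block is all true, an event of probability [2^-1 ^+ K]. *)
Lemma nonadaptive_upper_bound :
  exists s : {perm 'I_n},
    cost_nonadaptive f (fun _ => 1) (fun _ => 2^-1) s <=
    K%:R * run_length (fun T => (#|T| <= K)%N%:R * weight R T) ts
    + n%:R * (size ts)%:R * 2^-1 ^+ K.
Proof.
have inj : injective (tnth (Tuple size_test_order)).
  by apply/tuple_uniqP; exact: uniq_test_order.
exists (perm inj); rewrite /cost_nonadaptive.
under eq_bigr do rewrite prob_uniform nonadaptive_cost_onE.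
rewrite -mulr_sumr exprVn ler_pdivrMl ?exprn_gt0 //=.
have bound x : (tests_from f x set0 test_order)%:R <=
    K%:R * (blocks_run x ts)%:R +
    n%:R * \sum_(T <- ts | (K < #|T|)%N) (sat x [set j in block T])%:R :> R.
  rewrite -natr_sum -!natrM -natrD ler_nat.
  apply: leq_trans (tests_from_blocks _ _ _ (fun T H => H)) _.
  rewrite leq_add2l set0U; apply: leq_trans (tests_from_le _ _ _ _) _.
  apply: leq_mul (undetermined_after_blocks x).
  by rewrite size_filter -[leqRHS]size_enum_ord count_size.
apply: le_trans (ler_sum _ (fun x _ => bound x)) _.
rewrite big_split /= -!mulr_sumr sum_blocks_run // mulrDr mulrCA lerD2l.
rewrite exchange_big /= -!mulrA mulrCA ler_wpM2l //.
have -> : \sum_(T <- ts | (K < #|T|)%N) \sum_x (sat x [set j in block T])%:R =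
    \sum_(T <- ts | (K < #|T|)%N) 2^-1 ^+ K * 2 ^+ n :> R.
  apply: eq_bigr => T KT; rewrite -(card_block (ltnW KT)) -(sum1_inputs R).
  by rewrite -sum_sat //; apply: eq_bigr => x _; rewrite mulr1.
rewrite big_const_seq iter_addr_0 -[leLHS]mulr_natl mulrA [leRHS]mulrC ler_wpM2r ?exprn_ge0 //.
by rewrite ler_wpM2r ?exprn_ge0 ?invr_ge0 // ler_nat count_size.
Qed.

End UpperBound.

(** * Infimum over strategies, constant functions and choice of the block size *)

(** Testing all variables in turn works. Nonemptiness lets lower bounds pass to the infimum. *)
Lemma adaptive_strategy_exists n (f : input n -> bool) :
  exists t, adaptive_strategy f t.
Proof.
exists (foldr (fun i t => Node i t t) Leaf (enum 'I_n)) => x.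
suff H s A : determined f x (A :|: [set i in s]) ->
    run_ok f x A (foldr (fun i t => Node i t t) Leaf s).
  apply: H; apply/forallP => y; apply/implyP => /forall_inP yx.
  have -> // : y = x.
  by apply/ffunP => i; apply/eqP/yx; rewrite !inE mem_enum.
elim: s A => [|i s IHs] A /=.
  by rewrite (_ : A :|: _ = A) => [->|] //; apply/setP => j; rewrite !inE orbF.
by rewrite setUU1_seq => H; rewrite if_same IHs ?orbT.
Qed.

Lemma run_cost_ge0 (R : realType) n (f : input n -> bool) x A t :
  0 <= run_cost f (fun _ => 1 : R) x A t.
Proof.
elim: t A => [|i t0 IH0 t1 IH1] A /=; case: ifP => // _.
by case: (x i); rewrite addr_ge0.
Qed.

Lemma OPT_A_ge (R : realType) n (f : input n -> bool) (c p : 'I_n -> R) (r : R) :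
  (forall t, adaptive_strategy f t -> r <= cost_adaptive f c p t) ->
  r <= OPT_A f c p.
Proof.
move=> H; apply: lb_le_inf; last by move=> _ [t [ok ->]]; exact: H.
by have [t ok] := adaptive_strategy_exists f; exists (cost_adaptive f c p t), t.
Qed.

Lemma const_nonadaptive_cost (R : realType) n (f : input n -> bool)
    (c p : 'I_n -> R) s b :
  (forall x, f x = b) -> cost_nonadaptive f c p s = 0.
Proof.
move=> fb; rewrite /cost_nonadaptive big1 // => x _.
rewrite /nonadaptive_cost_on big1 ?mulr0 // => k _.
by rewrite ifT //; apply/forallP => y; rewrite !fb eqxx implybT.
Qed.

(** A repeated term would be disjoint from itself, hence empty. *)
Lemma pairwise_disjoint_in n (ts : seq {set 'I_n}) : set0 \notin ts ->
  pairwise (fun A B : {set 'I_n} => [disjoint A & B]) ts ->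
  uniq ts /\ {in ts &, forall T1 T2 : {set 'I_n}, T1 != T2 -> [disjoint T1 & T2]}.
Proof.
elim: ts => //= T s IHs; rewrite in_cons negb_or => /andP[T0 s0] /andP[/allP dT ps].
have [us ds] := IHs s0 ps; split.
  rewrite us andbT; apply/negP => /dT; rewrite -setI_eq0 setIid eq_sym.
  by rewrite (negbTE T0).
move=> T1 T2; rewrite !in_cons => /predU1P[->|T1s] /predU1P[->|T2s].
- by rewrite eqxx.
- by move=> _; exact: dT.
- by move=> _; rewrite disjoint_sym dT.
- exact: ds.
Qed.

(** Writing the rounded-up logarithm as [k + 1] gives [2 ^ k < n], and the extra [ln 2] is at most
    [ln n]. *)
Lemma up_log2_le_ln (R : realType) n : (2 <= n)%N ->
  (up_log 2 n)%:R <= 2 / ln 2 * ln (n%:R : R).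
Proof.
move=> n2; have ln2 : 0 < ln (2 : R) by rewrite ln_gt0 // ltr1n.
have n0 : 0 < n%:R :> R by rewrite ltr0n (leq_trans _ n2).
have : (0 < up_log 2 n)%N by rewrite up_log_gt0.
have := up_log_gtn (isT : 1 < 2)%N n2; case: (up_log 2 n) => // k /= kn _.
rewrite mulrAC ler_pdivlMr // -natr1.
have h1 : ln (2 : R) <= ln n%:R by rewrite ler_ln ?posrE // ler_nat.
have h2 : k%:R * ln 2 <= ln (n%:R : R).
  by rewrite mulr_natl -lnXn // ler_ln ?posrE ?exprn_gt0 // -natrX ler_nat ltnW.
lra.
Qed.

Theorem theorem1 (R : realType) :
  exists C : R, 0 < C /\
    forall (n : nat) (f : input n -> bool), (2 <= n)%N -> read_once_DNF f ->
      exists s : {perm 'I_n},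
        cost_nonadaptive f (fun _ => 1) (fun _ => 2^-1) s
        <= C * ln (n%:R : R) * OPT_A f (fun _ => 1) (fun _ => 2^-1).
Proof.
have ln2 : 0 < ln (2 : R) by rewrite ln_gt0 // ltr1n.
(* [12 = 3 * 4]: the cost is at most [3 * K * r], and [K] is at most [4 / ln 2 * ln n]. *)
exists (12 / ln 2); split; first by rewrite divr_gt0.
move=> n f n2 [ts0 [dts0 fE0]].
have n0 : 0 < n%:R :> R by rewrite ltr0n (leq_trans _ n2).
have lnn : 0 <= ln (n%:R : R) by rewrite ln_ge0 // ler1n (leq_trans _ n2).
(* An empty term or an empty list of terms makes [f] constant, and then nothing is tested. *)
have const_case b : (forall x, f x = b) ->
    exists s : {perm 'I_n}, cost_nonadaptive f (fun _ => 1) (fun _ => 2^-1) s <=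
      12 / ln 2 * ln n%:R * OPT_A f (fun _ => 1) (fun _ => 2^-1 : R).
  move=> fb; exists 1%g; rewrite (const_nonadaptive_cost _ _ _ fb).
  rewrite !mulr_ge0 ?invr_ge0 ?(ltW ln2) //; apply: OPT_A_ge => t _.
  apply: sumr_ge0 => x _; rewrite prob_uniform mulr_ge0 ?run_cost_ge0 //.
  by rewrite exprn_ge0 ?invr_ge0.
have [ts0_0 | ts0_n0] := boolP (set0 \in ts0).
  apply: (const_case true) => x; rewrite fE0; apply/hasP; exists set0 => //.
  by apply/forall_inP => i; rewrite inE.
have [uts0 ddts0] := pairwise_disjoint_in ts0_n0 dts0.
pose leT (T1 T2 : {set 'I_n}) := weight R T2 <= weight R T1.
pose ts := sort leT ts0.
have fE x : f x = has (sat x) ts by rewrite fE0; apply/esym/eq_has_r/mem_sort.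
have uts : uniq ts by rewrite sort_uniq.
have tsn0 : set0 \notin ts by rewrite mem_sort.
have dts : {in ts &, forall T1 T2 : {set 'I_n}, T1 != T2 -> [disjoint T1 & T2]}.
  by move=> T1 T2; rewrite !mem_sort; exact: ddts0.
have sts : sorted leT ts by apply: sort_sorted => T1 T2; exact: le_total.
have [ts_nil | ts_nnil] := eqVneq ts [::].
  by apply: (const_case false) => x; rewrite fE ts_nil.
(* The factor [2] gives [n ^ 2 <= 2 ^ K], which makes [tail] at most [1]. *)
pose K := (2 * up_log 2 n)%N.
have K0 : (0 < K)%N by rewrite muln_gt0 up_log_gt0 n2.
have nK : n%:R * n%:R * 2^-1 ^+ K <= 1 :> R.
  rewrite exprVn ler_pdivrMr ?exprn_gt0 // mul1r -natrM -natrX ler_nat.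
  by rewrite /K mulnC expnM -mulnn leq_mul // up_logP.
have mn : (size ts)%:R <= n%:R :> R by rewrite ler_nat (size_terms uts dts tsn0 K0).
have [s cost_s] := nonadaptive_upper_bound R fE uts dts K.
exists s; apply: le_trans cost_s _.
set r' := run_length _ _; pose r := run_length (@weight R n) ts.
have r_opt : r <= OPT_A f (fun _ => 1) (fun _ => 2^-1).
  by apply: OPT_A_ge => t ok; exact: adaptive_lower_bound.
have r1 : 1 <= r.
  rewrite /r; case: (ts) ts_nnil => //= T s' _; rewrite lerDl.
  by rewrite mulr_ge0 ?subr_ge0 ?weight_le1 // run_length_ge0 // => V; exact: weight_le1.
have w0 : 0 <= 2^-1 ^+ K :> R by rewrite exprn_ge0 ?invr_ge0.
have tail : n%:R * (size ts)%:R * 2^-1 ^+ K <= 1 :> R.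
  by apply: le_trans nK; rewrite ler_wpM2r // ler_wpM2l // ltW.
(* At most [n] terms of weight at most [2^-1 ^+ K] give at most [1 / n]. *)
have long_weight : \sum_(T <- ts | ~~ (#|T| <= K)%N) weight R T <= 2^-1.
  apply: (@le_trans _ _ ((size ts)%:R * 2^-1 ^+ K)).
    rewrite -sum1_size natr_sum mulr_suml big_mkcond; apply: ler_sum => T _.
    rewrite mul1r; case: ifP => // TK; rewrite /weight ler_wiXn2l ?invr_ge0 //.
      by rewrite invf_le1 // ler1n.
    by rewrite ltnW // ltnNge.
  have : 2 <= n%:R :> R by rewrite ler_nat.
  have : 0 <= (size ts)%:R * 2^-1 ^+ K :> R by rewrite mulr_ge0.
  by nra.
have r'_ge0 : 0 <= r'.
  apply: run_length_ge0 => T.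
  by case: (_ <= _)%N; rewrite ?mul1r ?mul0r ?weight_le1.
have r'r : r' <= 2 * r.
  have w01 (T : {set 'I_n}) : 0 <= weight R T <= 1 by rewrite weight_ge0 weight_le1.
  have := run_length_ignore (fun T : {set 'I_n} => (#|T| <= K)%N) ts w01.
  by rewrite -/r -/r'; nra.
have K1 : 1 <= K%:R :> R by rewrite ler1n.
have Kln : K%:R <= 4 / ln 2 * ln (n%:R : R).
  by have := up_log2_le_ln R n2; rewrite /K natrM; lra.
(* [K * r'] is at most [2 * K * r], and the tail is absorbed into [K * r] since [K] and [r] are at
   least [1]. *)
apply: (@le_trans _ _ (3 * K%:R * r)); first by nra.
apply: (@le_trans _ _ (12 / ln 2 * ln n%:R * r)).
  by rewrite ler_wpM2r; lra.
by rewrite ler_wpM2l // mulr_ge0 // divr_ge0 // ltW.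
Qed.
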